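(* Let $r>0$, $0\le R<\infty$, $\varkappa=R/r$, and let $P$ be a random point uniformly distributed over the area of the disk $D_R$. Let $A_\varkappa$ be the area of the ellipse generated by $P$ under the elliptic motion. Then for every $k=1,2,\ldots$ the $k$-th moment of $A_\varkappa$ is $$ \mathbb{E}\big[A_\varkappa^k\big]= \begin{cases} \pi^k r^{2k} & \text{if } \varkappa=0,\\[4pt] \dfrac{\pi^k r^{2k}}{k+1}\,\dfrac{1-(1-\varkappa^2)^{k+1}}{\varkappa^2} & \text{if } 0<\varkappa\le 1,\\[8pt] \dfrac{\pi^k r^{2k}}{k+1}\,\dfrac{1+(\varkappa^2-1)^{k+1}}{\varkappa^2} & \text{if } 1<\varkappa<\infty. \end{cases} $$
   Context: Elliptic motion: a circle of radius $r$ with centre $\varOmega$, attached to a moving plane $\varSigma$ with Cartesian coordinates $(\xi,\eta)$ and origin $\varOmega$, rolls inside a fixed circle of radius $2r$ centred at the origin $O$ of a fixed plane. A point $P=(\xi,\eta)\in\varSigma$ generates in the fixed plane (identified with $\mathbb{C}$) the closed curve $$X(\varphi)=r\,\mathrm{e}^{\mathrm{i}\varphi}+(\xi+\mathrm{i}\eta)\,\mathrm{e}^{-\mathrm{i}\varphi},\qquad 0\le\varphi<2\pi .$$ With $\varrho=\sqrt{\xi^2+\eta^2}$ this is an ellipse with semi-axes $r+\varrho$ and $|r-\varrho|$ (degenerating to a doubly traversed line segment, of enclosed area $0$, if $\varrho=r$). ''The ellipse generated by $P$'' means this curve, and its area is the area of the region it encloses, i.e. $\pi|r^2-\varrho^2|$.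 The disk is $D_R=\{(\xi,\eta)\in\varSigma: 0\le\xi^2+\eta^2\le R^2\}$. For $R=0$ the disk is the single point $\varOmega$ and $P=\varOmega$. *)

(* Defs.v *)
From HB Require Import structures.
From mathcomp Require Import all_boot all_order all_algebra.
From mathcomp Require Import complex.
From mathcomp Require Import all_classical all_reals all_analysis.

Set Implicit Arguments.
Unset Strict Implicit.
Unset Printing Implicit Defensive.

Import Order.TTheory GRing.Theory Num.Theory.
Import numFieldNormedType.Exports.

Local Open Scope classical_set_scope.
Local Open Scope complex_scope.
Local Open Scope ring_scope.

Definition cexpi (F : realType) (t : F) : F[i] := cos t +i* sin t.

(* Points of the moving plane are pairs of coordinates (xi, eta); the generated
   curve lives in the fixed plane, seen as the complex numbers. *)
Definition elliptic_motion (F : realType) (r : F) (p : F * F) (phi : F) : F[i] :=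
  r%:C * cexpi phi + (p.1 +i* p.2) * cexpi (- phi).

(* [F * F] carries the topology and the measure used below, hence the passage
   from z to (Re z, Im z). *)
Definition coords (F : realType) (z : F[i]) : F * F :=
  (complex.Re z, complex.Im z).

Definition generated_curve (F : realType) (r : F) (p : F * F) : set (F * F) :=
  [set coords (elliptic_motion r p phi) | phi in `[0, 2 * pi[].

(* The union of the bounded connected components of the complement of C; it is
   empty when C is a line segment. *)
Definition enclosed_region (F : realType) (C : set (F * F)) : set (F * F) :=
  [set z | ~ C z /\ bounded_set (connected_component (~` C) z)].

(* [measurableTypeR F] is F with the Borel sets on which [lebesgue_measure] is
   declared; the carrier of [plane F] is F * F. *)
Notation plane F := (measurableTypeR F * measurableTypeR F)%type.

Definition plane_area (F : realType) : set (F * F) -> \bar F :=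
  (@lebesgue_measure F \x @lebesgue_measure F)%E.

(* [fine] only changes the type: the enclosed region is bounded, so its area is
   finite. *)
Definition ellipse_area (F : realType) (r : F) (p : F * F) : F :=
  fine (plane_area (enclosed_region (generated_curve r p))).

Definition disk (F : realType) (R : F) : set (F * F) :=
  [set p | 0 <= p.1 ^+ 2 + p.2 ^+ 2 <= R ^+ 2].

(* The disk of radius 0 has zero area; the uniform law on it is the point mass
   at the origin. *)
Definition uniform_disk (F : realType) (R : F) (B : set (F * F)) : \bar F :=
  if R == 0 then \d_((0, 0) : plane F) B
  else ((fine (plane_area (disk R)))^-1%:E * plane_area (B `&` disk R))%E.

Definition uniformly_distributed_on_disk (d : measure_display)
    (T : measurableType d) (F : realType) (Pr : probability T F) (R : F)
    (P : {RV Pr >-> plane F}) : Prop :=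
  forall B : set (plane F), measurable B -> distribution Pr P B = uniform_disk R B.

(* Main.v *)
Require Import Defs.
From HB Require Import structures.
From mathcomp Require Import all_boot all_order all_algebra.
From mathcomp Require Import ring lra.
From mathcomp Require Import complex.
From mathcomp Require Import all_classical all_reals all_analysis measurable_realfun.

Import Order.TTheory GRing.Theory Num.Theory.
Import numFieldNormedType.Exports.

Local Open Scope classical_set_scope.
Local Open Scope ring_scope.

(** Write P = (xi, eta) and D = r^2 - xi^2 - eta^2.  The curve generated by P is
    the image of the unit circle under the symmetric matrix
    M = [r + xi, eta; eta, r - xi], whose determinant is D; its points
    are M u with |u| = 1 ([generated_curveP]).

    If D <> 0, then M is invertible and, with Q w = |adj M w|^2 = D^2 |M^-1 w|^2,
    the curve is the level set Q = D^2.  A point with Q < D^2 cannot be joined to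
    one with Q >= D^2 off the curve, because Q maps connected sets to intervals;
    a point with Q > D^2 is the origin of a ray pointing away from 0 on which Q
    only grows, so its component is unbounded.  Hence the enclosed region is the
    filled ellipse Q < D^2 ([enclosed_region_ellipse]).  If D = 0, then M is 2r
    times an orthogonal projection onto a line and the curve is a segment centred
    at 0; the same rays show that it encloses nothing
    ([enclosed_region_segment]).

    The vertical sections of the filled ellipse are intervals of length
    2 m sqrt(a^2 - x^2), so that its area is a multiple of the area of a half
    disk.  This gives pi |D| in all cases ([ellipse_areaE]).  The same computation
    gives the area pi s of the disk of squared radius s.  So for R > 0
    the variable xi^2 + eta^2 is uniform on [0, R^2]: both laws agree on the rays
    ]-oo, x[ ([uniform_disk_ray], [uniform_prob_ray], [eq_measure_rays]).  The
    k-th moment is then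

      R^-2 * integral over s from 0 to R^2 of (pi |r^2 - s|)^k,

    an elementary integral, with a change of sign at s = r^2 when R > r
    ([integral_abs_pow]).  For R = 0 the law of P is the point mass at 0. *)

(** * The area of a half disk *)

Lemma integral_FTC (F : realType) (f G : F -> F) (a b : F) :
  a <= b -> (forall x : F, is_derive x 1 G (f x)) -> continuous f ->
  (\int[lebesgue_measure]_(x in `[a, b]) (f x)%:E = (G b - G a)%:E)%E.
Proof.
rewrite le_eqVlt => /predU1P[<- dG cf|ab dG cf].
  by rewrite set_itv1 integral_set1 subrr.
have cG : continuous G.
  by move=> x; apply/differentiable_continuous/derivable1_diffP; have [] := dG x.
rewrite EFinB; apply: continuous_FTC2 => //.
- exact: continuous_subspaceT.
- split; first by move=> x _; have [] := dG x.
  + by apply: cvg_at_right_filter; exact: cG.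
  + by apply: cvg_at_left_filter; exact: cG.
- by move=> x _; rewrite derive1E; have [] := dG x.
Qed.

(** The substitution x = a sin t turns the integrand into (a cos t)^2, which has
    the primitive a^2/2 (t + sin t cos t).  A primitive in x involves arcsin,
    whose derivative is infinite at the end points. *)
Lemma integral_half_disk (F : realType) (a : F) : 0 <= a ->
  (\int[lebesgue_measure]_(x in `[(- a)%R, a]) (Num.sqrt (a ^+ 2 - x ^+ 2))%R%:E
   = (pi / 2 * a ^+ 2)%R%:E)%E.
Proof.
rewrite le_eqVlt => /predU1P[<-|a0].
  by rewrite oppr0 set_itv1 integral_set1 expr0n mulr0.
pose S := fun t : F => a * sin t.
have dS (x : F) : is_derive x 1 S (a * cos x).
  by apply: is_derive_eq; rewrite /GRing.scale/=; ring.
have S' : (derive1 S) = fun x => a * cos x.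
  by apply/funext => x; rewrite derive1E; have [] := dS x.
have cS : continuous S.
  by move=> x; apply/differentiable_continuous/derivable1_diffP; have [] := dS x.
have cS' : continuous (derive1 S).
  rewrite S' => x; apply: cvgM; [exact: cvg_cst|exact: continuous_cos].
have pi0 := @pi_gt0 F.
have Sa : S (pi / 2) = a by rewrite /S sin_pihalf mulr1.
have SNa : S (- (pi / 2)) = - a by rewrite /S sinN sin_pihalf mulrN1.
have -> : `[- a, a]%classic = `[S (- (pi / 2)), S (pi / 2)]%classic.
  by rewrite Sa SNa.
rewrite integration_by_substitution_increasing; last first.
- apply: continuous_subspaceT => x.
  apply: (@continuous_comp F F F (fun y : F => a ^+ 2 - y ^+ 2) (@Num.sqrt F)).
    apply: cvgB; [exact: cvg_cst|exact: exprn_continuous].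
  exact: sqrt_continuous.
- split; first by move=> x _; have [] := dS x.
  + by apply: cvg_at_right_filter; exact: cS.
  + by apply: cvg_at_left_filter; exact: cS.
- by apply/cvg_ex; exists ((derive1 S) (pi / 2));
  apply: cvg_at_left_filter; exact: cS'.
- by apply/cvg_ex; exists ((derive1 S) (- (pi / 2)));
  apply: cvg_at_right_filter; exact: cS'.
- by move=> x _; exact: cS'.
- by move=> x y xi yi xy; rewrite /S ltr_pM2l// ltr_sin.
- lra.
transitivity (\int[lebesgue_measure]_(x in `[(- (pi / 2))%R, (pi / 2)%R])
    ((a * cos x) ^+ 2)%R%:E)%E.
  apply: eq_integral => x; rewrite inE/= in_itv/= => xi.
  have c0 : 0 <= cos x by apply: cos_ge0_pihalf; exact: xi.
  congr EFin; rewrite S' !fctE /S.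
  have -> : a ^+ 2 - (a * sin x) ^+ 2 = (a * cos x) ^+ 2.
    by rewrite !exprMn cos2sin2; ring.
  by rewrite sqrtr_sqr ger0_norm ?mulr_ge0 ?(ltW a0)// expr2.
pose G := fun t : F => a ^+ 2 / 2 * (t + sin t * cos t).
have dG (x : F) : is_derive x 1 G ((a * cos x) ^+ 2).
  apply: is_derive_eq; rewrite /GRing.scale/=.
  by rewrite mulrN -!expr2 sin2cos2; field.
have cf : continuous (fun x : F => (a * cos x) ^+ 2).
  move=> x; apply: (@continuous_comp F F F (fun y : F => a * cos y)
      (fun y : F => y ^+ 2)); last exact: exprn_continuous.
  by apply: cvgM; [exact: cvg_cst|exact: continuous_cos].
have Npi : - (pi / 2) <= pi / 2 :> F by lra.
rewrite (integral_FTC F _ G _ _ Npi dG cf) /G sinN cosN cos_pihalf.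
by congr EFin; field.
Qed.

(** * Plane sets with elliptic sections *)

Lemma lebesgue_measure_sqr_lt (F : realType) (c s : F) :
  lebesgue_measure ([set y | (y - c) ^+ 2 < s] : set (measurableTypeR F))
  = (2 * Num.sqrt s)%:E.
Proof.
have [s0|s0] := leP s 0.
  rewrite (_ : [set _ | _] = set0) ?measure0 ?ler0_sqrtr ?mulr0//.
  by apply/seteqP; split => // y /=; rewrite ltNge (le_trans s0 (sqr_ge0 _)).
rewrite (_ : [set _ | _] = `]c - Num.sqrt s, c + Num.sqrt s[%classic).
  rewrite lebesgue_measure_itv/= lte_fin ifT -?EFinB.
    by congr EFin; ring.
  by have : 0 < Num.sqrt s by [rewrite sqrtr_gt0]; lra.
rewrite (_ : [set _ | _] = [set y | `|y - c| < Num.sqrt s]).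
  by apply/seteqP; split => y /=; rewrite in_itv/= ltr_distl.
apply/funext => y /=; congr is_true.
by rewrite -[in LHS](sqr_sqrtr (ltW s0)) -(@real_normK _ (y - c)) ?num_real//
  ltr_sqr ?nnegrE ?sqrtr_ge0.
Qed.

Lemma lebesgue_measure_sqr_le (F : realType) (c s : F) :
  lebesgue_measure ([set y | (y - c) ^+ 2 <= s] : set (measurableTypeR F))
  = (2 * Num.sqrt s)%:E.
Proof.
have [s0|s0] := ltP s 0.
  rewrite (_ : [set _ | _] = set0) ?measure0 ?ler0_sqrtr ?(ltW s0) ?mulr0//.
  by apply/seteqP; split => // y /=; rewrite leNgt (lt_le_trans s0 (sqr_ge0 _)).
rewrite (_ : [set _ | _] = `[c - Num.sqrt s, c + Num.sqrt s]%classic).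
  rewrite lebesgue_measure_itv/= lte_fin.
  case: ifPn => [_|]; first by rewrite -EFinB; congr EFin; ring.
  by have := sqrtr_ge0 s; move=> ? ?; congr EFin; lra.
rewrite (_ : [set _ | _] = [set y | `|y - c| <= Num.sqrt s]).
  by apply/seteqP; split => y /=; rewrite in_itv/= ler_distl.
apply/funext => y /=; congr is_true.
by rewrite -[in LHS](sqr_sqrtr s0) -(@real_normK _ (y - c)) ?num_real//
  ler_sqr ?nnegrE ?sqrtr_ge0.
Qed.

(** The product measure integrates the lengths of the vertical sections; here
    they are those of an ellipse of half-width a, up to a shear, which moves
    the sections without changing their lengths. *)
Lemma plane_area_elliptic_sections (F : realType) (E : set (plane F)) (m a : F) :
  0 <= m -> 0 <= a ->
  (forall x, lebesgue_measure (xsection E x)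
     = (2 * m * Num.sqrt (a ^+ 2 - x ^+ 2))%:E) ->
  plane_area E = (pi * m * a ^+ 2)%:E.
Proof.
move=> m0 a0 sec.
rewrite /plane_area /= /product_measure1 /=.
under eq_integral do rewrite sec EFinM.
have mf : measurable_fun (setT : set (measurableTypeR F))
    (fun x => (Num.sqrt (a ^+ 2 - x ^+ 2) : F)%:E : \bar F).
  apply/measurable_EFinP; apply: continuous_measurable_fun => x.
  apply: (@continuous_comp F F F (fun y : F => a ^+ 2 - y ^+ 2) (@Num.sqrt F)).
    apply: cvgB; [exact: cvg_cst|exact: exprn_continuous].
  exact: sqrt_continuous.
rewrite ge0_integralZl_EFin ?mulr_ge0//.
transitivity ((2 * m)%:E * (pi / 2 * a ^+ 2)%R%:E)%E; last first.
  by rewrite -EFinM; congr EFin; field.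
congr (_ * _)%E; rewrite -integral_half_disk// [RHS]integral_mkcond.
apply: eq_integral => x _; rewrite patchE; case: ifPn => //.
rewrite notin_setE/= in_itv/= -ler_norml => /negP; rewrite -ltNge => ax.
rewrite ler0_sqrtr// subr_le0 -(@real_normK _ x) ?num_real//.
by rewrite ler_sqr ?nnegrE// ltW.
Qed.

(** * The generated curve as a linear image of the circle *)

Lemma unit_circle_angle (F : realType) (u v : F) : u ^+ 2 + v ^+ 2 = 1 ->
  exists2 phi, 0 <= phi < 2 * pi & cos phi = u /\ sin phi = v.
Proof.
move=> uv1; have pi0 := @pi_gt0 F.
have u1 : -1 <= u <= 1 by apply/andP; split; nra.
have ca : cos (acos u) = u by apply: acosK; rewrite in_itv.
have sa : sin (acos u) = `|v|.
  by rewrite sin_acos// (_ : 1 - u ^+ 2 = v ^+ 2) ?sqrtr_sqr//; lra.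
have [v0|v0] := leP 0 v.
  exists (acos u); last by rewrite sa ger0_norm.
  have := acos_ge0 u1; have := acos_lepi u1; lra.
have a0 : 0 < acos u by apply: acos_gt0; apply/andP; split; nra.
exists (- acos u + pi *+ 2).
  have := acos_lepi u1; rewrite mulr2n; lra.
by rewrite cosD2pi sinD2pi cosN sinN ca sa ltr0_norm// opprK.
Qed.

(** In real coordinates the motion applies the symmetric matrix
    [r + xi, eta; eta, r - xi] to the unit vector (cos phi, sin phi). *)
Lemma generated_curveP (F : realType) (r : F) (p z : F * F) :
  generated_curve r p z <-> exists u v, u ^+ 2 + v ^+ 2 = 1 /\
    z = ((r + p.1) * u + p.2 * v, p.2 * u + (r - p.1) * v).
Proof.
case: p => x y; have motionE phi : coords (elliptic_motion r (x, y) phi) =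
    ((r + x) * cos phi + y * sin phi, y * cos phi + (r - x) * sin phi).
  rewrite /coords /elliptic_motion /cexpi /= cosN sinN.
  by congr pair; ring.
split=> [[phi _ <-]|[u [v [uv1 ->]]]].
  by exists (cos phi), (sin phi); rewrite cos2Dsin2 motionE.
have [phi phi2 [<- <-]] := unit_circle_angle _ _ _ uv1.
by exists phi; rewrite ?motionE//= in_itv.
Qed.

Lemma bounded_set_planeP (F : realType) (A : set (F * F)) :
  bounded_set A <-> exists M, forall w, A w -> `|w.1| <= M /\ `|w.2| <= M.
Proof.
split.
  move=> /ex_strict_bound_gt0[M _ AM]; exists M => w /AM /=.
  by rewrite prod_normE gt_max => /andP[/ltW w1 /ltW w2].
case=> M AM; exists M; split; first exact: num_real.
move=> N /ltW MN w /AM [w1 w2] /=.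
by rewrite prod_normE ge_max (le_trans w1 MN) (le_trans w2 MN).
Qed.

(** The half-line from z away from the origin is connected and unbounded, hence
    so is the component of z as soon as this half-line misses C. *)
Lemma not_enclosed_ray (F : realType) (C : set (F * F)) (z : F * F) :
  (forall t, 1 <= t -> ~ C (t * z.1, t * z.2)) -> z <> (0, 0) ->
  ~ enclosed_region C z.
Proof.
move=> raz z0 [_ /bounded_set_planeP[M compM]].
pose ray t := (t * z.1, t * z.2) : F * F.
have cray : continuous ray.
  move=> t; have mulcvg c : s * c @[s --> t] --> t * c.
    by apply: cvgM; [exact: cvg_id|exact: cvg_cst].
  exact: (cvg_pair (mulcvg z.1) (mulcvg z.2)).
have ray1 : ray 1 = z by rewrite /ray !mul1r -surjective_pairing.
have sub : ray @` `[1, +oo[ `<=` connected_component (~` C) z.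
  apply: connected_component_max.
  - by exists 1; rewrite //= in_itv/= lexx.
  - by move=> _ [t /= + <-]; rewrite in_itv/= andbT; exact: raz.
  - apply: connected_continuous_connected; last exact: continuous_subspaceT.
    exact/connected_intervalP/interval_is_interval.
have M0 : 0 <= M.
  have [|z1M _] := compM (ray 1); last exact: le_trans z1M.
  by apply: sub; exists 1; rewrite //= in_itv/= lexx.
have far c : c != 0 -> exists2 t, 1 <= t & M < `|t * c|.
  move=> c0; have c0' : 0 < `|c| by rewrite normr_gt0.
  exists (1 + M / `|c|); first by rewrite lerDl divr_ge0.
  rewrite normrM ger0_norm ?addr_ge0 ?divr_ge0// mulrDl mul1r divfK ?gt_eqF//.
  by rewrite ltrDr.
have [z1|z1] := eqVneq z.1 0; last first.
  have [t t1] := far _ z1; rewrite ltNge => /negP; apply.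
  by have [|] := compM (ray t); first by apply: sub; exists t; rewrite //= in_itv/= t1.
have [z2|z2] := eqVneq z.2 0.
  by apply: z0; rewrite (surjective_pairing z) z1 z2.
have [t t1] := far _ z2; rewrite ltNge => /negP; apply.
by have [|] := compM (ray t); first by apply: sub; exists t; rewrite //= in_itv/= t1.
Qed.

(** * The region enclosed by a nondegenerate ellipse *)

(** The squared norm of adj M w, where M is the matrix of the curve.  The adjugate
    rather than the inverse keeps the expression polynomial in p. *)
Definition curve_form {F : realType} (r : F) (p w : F * F) : F :=
  ((r - p.1) * w.1 - p.2 * w.2) ^+ 2 + ((r + p.1) * w.2 - p.2 * w.1) ^+ 2.

(** The determinant of the matrix of the curve. *)
Definition curve_det {F : realType} (r : F) (p : F * F) : F :=
  r ^+ 2 - (p.1 ^+ 2 + p.2 ^+ 2).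

(** From adj M (M u) = D u, the form takes the value D^2 |u|^2 at M u; conversely
    w = M u for u = D^-1 adj M w. *)
Lemma generated_curve_level (F : realType) (r : F) (p : F * F) :
  curve_det r p != 0 ->
  generated_curve r p = [set w | curve_form r p w = curve_det r p ^+ 2].
Proof.
case: p => x y D0; apply/seteqP; split=> [w /generated_curveP|[wx wy] /= Qw].
  case=> u [v [uv1 ->]] /=; rewrite /curve_form /curve_det /=.
  by rewrite -[RHS]mulr1 -uv1; ring.
apply/generated_curveP.
set d := curve_det r (x, y) in D0 Qw *.
exists (((r - x) * wx - y * wy) / d), (((r + x) * wy - y * wx) / d).
rewrite /curve_form /= in Qw; split.
  by rewrite !expr_div_n -mulrDl Qw divff// expf_neq0.
have dE : d = r ^+ 2 - (x ^+ 2 + y ^+ 2) by [].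
congr pair; rewrite /= !mulrA -mulrDl; apply: (mulIf D0); rewrite divfK// dE;
  ring.
Qed.

Lemma curve_formZ (F : realType) (r t : F) (p w : F * F) :
  curve_form r p (t * w.1, t * w.2) = t ^+ 2 * curve_form r p w.
Proof. by rewrite /curve_form /=; ring. Qed.

Lemma continuous_curve_form (F : realType) (r : F) (p : F * F) :
  continuous (curve_form r p).
Proof.
have lin (a b : F) : continuous (fun w : F * F => a * w.1 - b * w.2).
  move=> w; apply: cvgB; apply: cvgM.
  - exact: cvg_cst.
  - exact: cvg_fst.
  - exact: cvg_cst.
  - exact: cvg_snd.
have -> : curve_form r p = (fun w : F * F =>
    ((r - p.1) * w.1 - p.2 * w.2) ^+ 2 + (p.2 * w.1 - (r + p.1) * w.2) ^+ 2).
  by apply/funext => w; rewrite /curve_form; ring.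
move=> w; apply: cvgD.
  apply: (@continuous_comp _ _ _ (fun w : F * F => (r - p.1) * w.1 - p.2 * w.2)
    (fun u : F => u ^+ 2)); [exact: lin|exact: exprn_continuous].
apply: (@continuous_comp _ _ _ (fun w : F * F => p.2 * w.1 - (r + p.1) * w.2)
    (fun u : F => u ^+ 2)); [exact: lin|exact: exprn_continuous].
Qed.

(** Outside, the form grows along rays by [curve_formZ].  Inside, the
    image of the component under the form is an interval that misses D^2; the
    region is bounded, being the image of the open unit disk under M. *)
Lemma enclosed_region_ellipse (F : realType) (r : F) (p : F * F) :
  curve_det r p != 0 ->
  enclosed_region (generated_curve r p)
  = [set w | curve_form r p w < curve_det r p ^+ 2].
Proof.
move=> D0; have curveE := generated_curve_level _ _ _ D0.
set d := curve_det r p in D0 curveE *.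
have d20 : 0 < d ^+ 2 by rewrite exprn_even_gt0.
apply/seteqP; split=> [z zin|z /= zQ].
  rewrite /= ltNge le_eqVlt; apply/negP => /predU1P[zC|Qz].
    by case: zin; rewrite curveE /= zC.
  apply: not_enclosed_ray zin => [t t1|z0]; last first.
    by move: Qz; rewrite z0 /curve_form /= !mulr0 subrr expr0n /= addr0 ltNge sqr_ge0.
  rewrite curveE /= curve_formZ; apply/eqP; rewrite gt_eqF//.
  by rewrite (lt_le_trans Qz)// ler_peMl ?(ltW (lt_trans _ Qz))//
    expr_ge1// (le_trans ler01).
split; first by rewrite curveE /=; apply/eqP; rewrite lt_eqF.
apply/bounded_set_planeP; exists (`|r + p.1| + `|p.2| + `|r - p.1|) => w compw.
have Qw : curve_form r p w < d ^+ 2.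
  rewrite ltNge; apply/negP => dQ.
  (* Otherwise the form takes the value D^2 on the component, by connectedness. *)
  have : is_interval (curve_form r p @` connected_component (~` generated_curve r p) z).
    apply/connected_intervalP/connected_continuous_connected.
      exact: component_connected.
    exact/continuous_subspaceT/continuous_curve_form.
  move=> /(_ (curve_form r p z) (curve_form r p w)) /(_ _ _ (d ^+ 2)).
  case.
  - exists z => //; apply: connected_component_refl; rewrite curveE /=.
    by apply/eqP; rewrite lt_eqF.
  - by exists w.
  - by rewrite (ltW zQ).
  - by move=> w' /connected_component_sub; rewrite curveE.
(* (U, V) = adj M w has norm less than |D|, and w = D^-1 M (U, V). *)
set U := (r - p.1) * w.1 - p.2 * w.2; set V := (r + p.1) * w.2 - p.2 * w.1.
have Ud : `|U| <= `|d|.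
  rewrite -ler_sqr ?nnegrE// !real_normK ?num_real// (le_trans _ (ltW Qw))//.
  by rewrite /curve_form lerDl sqr_ge0.
have Vd : `|V| <= `|d|.
  rewrite -ler_sqr ?nnegrE// !real_normK ?num_real// (le_trans _ (ltW Qw))//.
  by rewrite /curve_form lerDr sqr_ge0.
have w1 : w.1 * d = (r + p.1) * U + p.2 * V by rewrite /U /V /d /curve_det; ring.
have w2 : w.2 * d = p.2 * U + (r - p.1) * V by rewrite /U /V /d /curve_det; ring.
have bound c a b : c * d = a * U + b * V -> `|c| <= `|a| + `|b|.
  move=> cd; rewrite -(@ler_pM2r _ `|d|) ?normr_gt0// -normrM cd.
  by rewrite (le_trans (ler_normD _ _))// !normrM mulrDl lerD// ler_wpM2l.
split.
  by rewrite (le_trans (bound _ _ _ w1))// lerDl.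
by rewrite (le_trans (bound _ _ _ w2))// -addrA lerDr.
Qed.

(** * The degenerate curve and the area of the ellipse *)

(** A singular M equals 2r times the orthogonal projection onto the line
    spanned by e = (c, s), where e has half the polar angle of p.  So M u
    depends only on the component of u along e, which takes all values between
    -1 and 1 on the unit circle. *)
Lemma generated_segment_scale (F : realType) (r l : F) (p z : F * F) :
  0 < r -> curve_det r p = 0 -> 0 <= l <= 1 ->
  generated_curve r p z -> generated_curve r p (l * z.1, l * z.2).
Proof.
case: p z => x y [z1 z2] r0; rewrite /curve_det /= => d0 l01.
have rn0 : r != 0 by rewrite gt_eqF.
have [alpha _ [ca sa]] : exists2 phi, 0 <= phi < 2 * pi &
    cos phi = x / r /\ sin phi = y / r.
  apply: unit_circle_angle; rewrite !expr_div_n -mulrDl.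
  by rewrite (_ : _ + _ = r ^+ 2) ?divff ?expf_neq0//; lra.
set c := cos (alpha / 2); set s := sin (alpha / 2).
have cs1 : c ^+ 2 + s ^+ 2 = 1 by exact: cos2Dsin2.
have alphaE : alpha = alpha / 2 + alpha / 2 by field.
have xE : x = r * (c ^+ 2 - s ^+ 2).
  apply: (mulIf (invr_neq0 rn0)); rewrite -ca {1}alphaE cosD -/c -/s. by field.
have yE : y = r * (2 * c * s).
  by apply: (mulIf (invr_neq0 rn0)); rewrite -sa {1}alphaE sinD -/c -/s; field.
have s2 : s ^+ 2 = 1 - c ^+ 2 by lra.
have c2 : c ^+ 2 = 1 - s ^+ 2 by lra.
have rxE : r + x = 2 * r * c ^+ 2 by rewrite xE s2; ring.
have rNxE : r - x = 2 * r * s ^+ 2 by rewrite xE c2; ring.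
move=> /generated_curveP[u [v [uv1]]]; rewrite /= rxE rNxE yE => -[z1E z2E].
set k := l * (c * u + s * v).
have k1 : k ^+ 2 <= 1.
  case/andP: l01 => l0 l1; rewrite exprMn.
  apply: mulr_ile1; rewrite ?sqr_ge0//; first exact: exprn_ile1.
  have -> : (c * u + s * v) ^+ 2 = 1 - (c * v - s * u) ^+ 2.
    transitivity ((c ^+ 2 + s ^+ 2) * (u ^+ 2 + v ^+ 2) - (c * v - s * u) ^+ 2).
      by ring.
    by rewrite cs1 uv1 mulr1.
  by rewrite lerBlDr lerDl sqr_ge0.
have w2 : Num.sqrt (1 - k ^+ 2) ^+ 2 = 1 - k ^+ 2 by rewrite sqr_sqrtr// subr_ge0.
set w := Num.sqrt _ in w2.
(* The component along e is rescaled to k; w completes it to a unit vector. *)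
apply/generated_curveP; exists (k * c - w * s), (k * s + w * c); split.
  have -> : (k * c - w * s) ^+ 2 + (k * s + w * c) ^+ 2
      = (k ^+ 2 + w ^+ 2) * (c ^+ 2 + s ^+ 2) by ring.
  by rewrite cs1 w2; ring.
rewrite /= rxE rNxE z1E z2E; congr pair.
  transitivity (2 * r * c * k * (c ^+ 2 + s ^+ 2)); last by ring.
  by rewrite cs1 /k; ring.
transitivity (2 * r * s * k * (c ^+ 2 + s ^+ 2)); last by ring.
by rewrite cs1 /k; ring.
Qed.

(** The segment is stable under shrinking towards 0, so a ray that leaves a point
    off the segment never meets it. *)
Lemma enclosed_region_segment (F : realType) (r : F) (p : F * F) :
  0 < r -> curve_det r p = 0 -> enclosed_region (generated_curve r p) = set0.
Proof.
move=> r0 d0; apply/seteqP; split=> // z zin.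
have [zC _] := zin; apply: not_enclosed_ray zin => [t t1 tC|z0]; apply: zC.
  have t0 : 0 < t by rewrite (lt_le_trans ltr01).
  have := generated_segment_scale _ _ t^-1 _ _ r0 d0 _ tC.
  rewrite /= !mulKf ?gt_eqF// -surjective_pairing; apply.
  by rewrite invr_ge0 ltW//= invf_le1.
have C1 : generated_curve r p (r + p.1, p.2).
  by apply/generated_curveP; exists 1, 0; split; [|congr pair]; ring.
have := generated_segment_scale _ _ 0 _ _ r0 d0 _ C1.
by rewrite /= !mul0r z0; apply; rewrite lexx ler01.
Qed.

(** Completing the square in y, the section of the filled ellipse at x is
    (y - 2 r eta x / a)^2 < (D / a)^2 (a - x^2), where a is the squared norm of the
    first column of M. *)
Lemma ellipse_areaE (F : realType) (r : F) (p : F * F) : 0 < r ->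
  ellipse_area r p = pi * `|curve_det r p|.
Proof.
move=> r0; rewrite /ellipse_area.
have [d0|dn0] := eqVneq (curve_det r p) 0.
  rewrite enclosed_region_segment// d0 normr0 mulr0.
  by rewrite /plane_area measure0.
rewrite enclosed_region_ellipse//.
set d := curve_det r p in dn0 *.
set a := (r + p.1) ^+ 2 + p.2 ^+ 2.
have a0 : 0 < a.
  rewrite lt_def addr_ge0 ?sqr_ge0// andbT paddr_eq0 ?sqr_ge0// !sqrf_eq0.
  apply: contra dn0 => /andP[/eqP rp /eqP p2]; apply/eqP.
  by rewrite /d /curve_det p2 (_ : r = - p.1); [ring|lra].
have s0 : 0 < Num.sqrt a by rewrite sqrtr_gt0.
rewrite (plane_area_elliptic_sections _ _ (`|d| / a) (Num.sqrt a))//=.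
- by rewrite sqr_sqrtr ?(ltW a0)//; field; rewrite gt_eqF.
- by rewrite divr_ge0// ltW.
move=> x; rewrite (_ : xsection _ _ = [set y |
    (y - 2 * r * p.2 / a * x) ^+ 2 < (d / a) ^+ 2 * (a - x ^+ 2)]).
  rewrite lebesgue_measure_sqr_lt sqr_sqrtr ?(ltW a0)//.
  rewrite sqrtrM ?sqr_ge0// sqrtr_sqr normrM normfV (gtr0_norm a0).
  by congr EFin; ring.
rewrite /xsection; apply/funext => y /=; rewrite in_setE /=; apply/propext.
rewrite -subr_lt0 -[X in _ <-> is_true X]subr_lt0.
rewrite (_ : curve_form r p (x, y) - d ^+ 2
    = a * ((y - 2 * r * p.2 / a * x) ^+ 2 - (d / a) ^+ 2 * (a - x ^+ 2))).
  by rewrite pmulr_rlt0.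
have an0 : a != 0 by rewrite gt_eqF.
rewrite /curve_form /=.
have aE : a = (r + p.1) ^+ 2 + p.2 ^+ 2 by [].
have dE : d = r ^+ 2 - (p.1 ^+ 2 + p.2 ^+ 2) by [].
by rewrite !expr_div_n; field: aE dE.
Qed.

(** * The law of the squared distance to the centre *)

Definition sqr_norm {F : realType} (p : F * F) : F := p.1 ^+ 2 + p.2 ^+ 2.

Lemma plane_area_open_disk (F : realType) (s : F) : 0 <= s ->
  plane_area [set p | sqr_norm p < s] = (pi * s)%:E.
Proof.
move=> s0; rewrite (plane_area_elliptic_sections _ _ 1 (Num.sqrt s))//.
  by rewrite mulr1 sqr_sqrtr.
move=> x; rewrite mulr1 sqr_sqrtr// -(@lebesgue_measure_sqr_lt _ 0).
congr (lebesgue_measure _); apply/funext => y; rewrite /xsection/= in_setE/=.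
by rewrite /sqr_norm /= subr0 ltrBrDl.
Qed.

Lemma plane_area_closed_disk (F : realType) (s : F) : 0 <= s ->
  plane_area [set p | sqr_norm p <= s] = (pi * s)%:E.
Proof.
move=> s0; rewrite (plane_area_elliptic_sections _ _ 1 (Num.sqrt s))//.
  by rewrite mulr1 sqr_sqrtr.
move=> x; rewrite mulr1 sqr_sqrtr// -(@lebesgue_measure_sqr_le _ 0).
congr (lebesgue_measure _); apply/funext => y; rewrite /xsection/= in_setE/=.
by rewrite /sqr_norm /= subr0 lerBrDl.
Qed.

Lemma diskE (F : realType) (R : F) : disk R = [set p | sqr_norm p <= R ^+ 2].
Proof.
apply/funext => p; rewrite /disk /sqr_norm /=.
by rewrite addr_ge0 ?sqr_ge0.
Qed.

Lemma measurable_sqr_norm (F : realType) :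
  measurable_fun (setT : set (plane F)) (sqr_norm : plane F -> measurableTypeR F).
Proof.
by apply: measurable_funD; apply: measurable_funX;
  [exact: measurable_fst|exact: measurable_snd].
Qed.

Lemma uniform_prob_ray (F : realType) (b x : F) (b0 : 0 < b) :
  uniform_prob b0 `]-oo, x[ = (b^-1 * Num.max 0 (Num.min x b))%:E.
Proof.
transitivity (\int[uniform_prob b0]_y (\1_(`]-oo, x[%classic : set F) y)%:E)%E.
  by rewrite integral_indic// setIT.
rewrite integral_uniform; last 2 first.
- exact/measurable_EFinP/measurable_indic.
- by move=> y; rewrite lee_fin.
rewrite subr0 integral_indic// EFinM; congr (_ * _)%E.
transitivity (@lebesgue_measure F (`]-oo, x[ `&` `[0, b])) => //.
have [x0|x0] := leP x 0.
  rewrite (_ : _ `&` _ = set0) ?measure0.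
    rewrite max_l// ge_min x0//.
  apply/seteqP; split=> // y /=; rewrite !in_itv/= => -[yx /andP[y0 _]].
  by have := lt_le_trans yx x0; rewrite ltNge y0.
have [xb|bx] := leP x b.
  rewrite (_ : _ `&` _ = `[0, x[%classic).
    by rewrite lebesgue_measure_itv/= lte_fin x0 -EFinB subr0 max_r// ltW.
  apply/seteqP; split=> y /=; rewrite !in_itv/=.
    by move=> [-> /andP[-> _]].
  by move=> /andP[-> yx]; rewrite yx (ltW (lt_le_trans yx xb)).
rewrite (_ : _ `&` _ = `[0, b]%classic).
  by rewrite lebesgue_measure_itv/= lte_fin b0 -EFinB subr0 max_r// ltW.
apply/seteqP; split=> y /=; rewrite !in_itv/=; first by case.
by move=> /andP[-> yb]; rewrite yb (le_lt_trans yb bx).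
Qed.

(** The disk of squared radius x has area pi x, as long as it is contained in the
    disk of radius R. *)
Lemma uniform_disk_ray (F : realType) (R x : F) : 0 < R ->
  uniform_disk R (sqr_norm @^-1` `]-oo, x[)
  = ((R ^+ 2)^-1 * Num.max 0 (Num.min x (R ^+ 2)))%:E.
Proof.
move=> R0; rewrite /uniform_disk gt_eqF// diskE.
rewrite plane_area_closed_disk ?sqr_ge0//=.
have pi0 := @pi_gt0 F.
rewrite invfM [X in (X)%:E]mulrC EFinM [in RHS]EFinM -muleA; congr (_ * _)%E.
rewrite (_ : Num.max _ _ = pi^-1 * (pi * Num.max 0 (Num.min x (R ^+ 2)))).
  rewrite EFinM; congr (_ * _)%E.
  have [xR|Rx] := leP x (R ^+ 2).
    rewrite (_ : _ `&` _ = [set p | sqr_norm p < Num.max 0 x]).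
      by rewrite plane_area_open_disk ?le_max ?lexx.
    apply/seteqP; split=> p /=; rewrite in_itv/=.
      by move=> [px _]; rewrite lt_max px orbT.
    rewrite lt_max ltNge addr_ge0 ?sqr_ge0//= => px.
    by rewrite px (ltW (lt_le_trans px xR)).
  rewrite max_r ?sqr_ge0// -plane_area_closed_disk ?sqr_ge0//.
  congr plane_area; apply/seteqP; split=> p /=; rewrite in_itv/=; first by case.
  by move=> pR; rewrite pR (le_lt_trans pR Rx).
by rewrite mulKf// gt_eqF.
Qed.

(** The open lower rays are closed under intersection, generate the Borel sets and
    cover the line. *)
Lemma eq_measure_rays (F : realType)
    (mu nu : {measure set (measurableTypeR F) -> \bar F}) :
  (forall x : F, mu `]-oo, x[%classic < +oo)%E ->
  (forall x : F, mu `]-oo, x[%classic = nu `]-oo, x[%classic) ->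
  forall B, measurable B -> mu B = nu B.
Proof.
move=> mufin munu B mB.
apply: (@g_sigma_algebra_measure_unique _ F (measurableTypeR F)
  (@RGenInftyO.G F) _ (fun n => `]-oo, n%:R[%classic) _ _ mu nu).
- by move=> _ [x ->].
- by move=> n; exists n%:R.
- apply/seteqP; split=> // x _; exists (Num.truncn x).+1 => //=.
  by rewrite in_itv/= truncnS_gt.
- move=> _ _ [x ->] [y ->]; exists (Num.min x y).
  by apply/seteqP; split => z /=; rewrite !in_itv/= lt_min;
    [case=> -> ->|move=> /andP[-> ->]].
- by move=> _ [x ->]; exact: munu.
- by move=> n; exact: mufin.
- by move: mB; rewrite RGenInftyO.measurableE.
Qed.

(** * Moments of the absolute value of an affine function *)

Lemma integral_affine_pow (F : realType) (e c a b : F) (k : nat) :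
  e != 0 -> a <= b ->
  (\int[lebesgue_measure]_(s in `[a, b]) ((e * (s - c)) ^+ k)%R%:E
   = (((e * (b - c)) ^+ k.+1 - (e * (a - c)) ^+ k.+1) / (e * k.+1%:R))%R%:E)%E.
Proof.
move=> e0 ab; pose L (s : F) := e * (s - c).
have dL (s : F) : is_derive s 1 L e.
  by apply: is_derive_eq; rewrite /GRing.scale/=; ring.
have dLX (s : F) : is_derive s 1 (fun t => L t ^+ k.+1) (e * k.+1%:R * L s ^+ k).
  have -> : (fun t => L t ^+ k.+1) = L ^+ k.+1 by rewrite exprfctE.
  by apply: is_derive_eq; rewrite /GRing.scale/=; ring.
have cLX : continuous (fun s => L s ^+ k).
  move=> s; apply: (@continuous_comp F F F L (fun y : F => y ^+ k)).
    by apply/differentiable_continuous/derivable1_diffP; have [] := dL s.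
  exact: exprn_continuous.
have k0 : k.+1%:R != 0 :> F by rewrite pnatr_eq0.
rewrite mulrBl.
apply: (integral_FTC _ _ (fun s => L s ^+ k.+1 / (e * k.+1%:R))) => // s.
have -> : (fun s => L s ^+ k.+1 / (e * k.+1%:R))
    = (e * k.+1%:R)^-1 *: (fun t => L t ^+ k.+1).
  by apply/funext => t; rewrite mulrC.
by apply: is_derive_eq; rewrite /GRing.scale /= mulKf// mulf_neq0.
Qed.

Lemma measurable_abs_pow (F : realType) (e c : F) (k : nat)
    (A : set (measurableTypeR F)) :
  measurable_fun A (fun s => ((e * `|c - s|) ^+ k)%:E : \bar F).
Proof.
apply/measurable_EFinP/measurable_funX/measurable_funM => //.
by apply: measurableT_comp => //; exact: measurable_funB.
Qed.

(** The value is written with (c - b) |c - b|^k so that the cases b <= c and c < b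
    have the same formula; the factor under the power is affine on either side
    of c. *)
Lemma integral_abs_pow (F : realType) (e c b : F) (k : nat) :
  0 < e -> 0 <= c -> 0 <= b ->
  (\int[lebesgue_measure]_(s in `[0%R, b]) ((e * `|c - s|) ^+ k)%R%:E
   = (e ^+ k / k.+1%:R * (c ^+ k.+1 - (c - b) * `|c - b| ^+ k))%R%:E)%E.
Proof.
move=> e0 c0 b0.
have k0 : k.+1%:R != 0 :> F by rewrite pnatr_eq0.
have en0 : e != 0 by rewrite gt_eqF.
have below u : 0 <= u <= c ->
    (\int[lebesgue_measure]_(s in `[0%R, u]) ((e * `|c - s|) ^+ k)%R%:E
     = (e ^+ k / k.+1%:R * (c ^+ k.+1 - (c - u) ^+ k.+1))%R%:E)%E.
  move=> /andP[u0 uc].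
  transitivity (\int[lebesgue_measure]_(s in `[0%R, u]) ((- e * (s - c)) ^+ k)%R%:E)%E.
    apply: eq_integral => s; rewrite inE/= in_itv/= => /andP[_ su].
    rewrite ger0_norm ?subr_ge0 ?(le_trans su)//.
    by congr (_ ^+ k)%:E; ring.
  rewrite integral_affine_pow ?oppr_eq0//; congr EFin.
  have swap v : - e * (v - c) = e * (c - v) by ring.
  by rewrite !swap !exprMn subr0 (exprS e); field; rewrite nat1r k0 en0.
have [bc|cb] := leP b c.
  rewrite below ?b0//; rewrite ger0_norm ?subr_ge0//.
  by rewrite (exprS (c - b)).
have -> : `[0, b]%classic = `[0, c] `|` `]c, b].
  apply/seteqP; split=> s /=; rewrite !in_itv/=.
    by move=> /andP[s0 sb]; have [sc|cs] := leP s c; [left; rewrite s0|right].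
  move=> [/andP[-> sc]|/andP[cs ->]]; first by rewrite (le_trans sc (ltW cb)).
  by rewrite (le_trans c0 (ltW cs)).
rewrite ge0_integral_setU//=.
- rewrite integral_itv_obnd_cbnd; last exact: measurable_abs_pow.
  rewrite below ?c0 ?lexx//.
  transitivity ((e ^+ k / k.+1%:R * (c ^+ k.+1 - (c - c) ^+ k.+1))%R%:E +
      \int[lebesgue_measure]_(s in `[c, b]) ((e * (s - c)) ^+ k)%R%:E)%E.
    congr (_ + _)%E; apply: eq_integral => s; rewrite inE/= in_itv/= => /andP[cs _].
    by rewrite ler0_norm ?subr_le0// opprB.
  rewrite integral_affine_pow ?(ltW cb)// -EFinD; congr EFin.
  rewrite ltr0_norm ?subr_lt0// !subrr !mulr0 !expr0n/= !subr0 opprB.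
  by rewrite exprMn (exprS e) (exprS (b - c)); field; rewrite nat1r k0 en0.
- exact: measurable_abs_pow.
- by move=> s _; rewrite lee_fin exprn_ge0// mulr_ge0// ltW.
- apply/disj_setPS => s [/=]; rewrite !in_itv/= => /andP[_ sc] /andP[cs _].
  by move: cs; rewrite ltNge sc.
Qed.

(** * The moments of the area *)

Theorem theorem2p1 (F : realType) (d : measure_display) (T : measurableType d)
    (Pr : probability T F) (r R : F) (hr : 0 < r) (hR : 0 <= R)
    (P : {RV Pr >-> plane F}) (hP : uniformly_distributed_on_disk R P)
    (k : nat) (hk : (1 <= k)%N) :
  let kappa := R / r in
  ('E_Pr[fun w => (ellipse_area r (P w) ^+ k)%R])%E =
   (if kappa == 0 then pi ^+ k * r ^+ (2 * k)
    else if kappa <= 1 then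
      pi ^+ k * r ^+ (2 * k) / k.+1%:R
        * ((1 - (1 - kappa ^+ 2) ^+ k.+1) / kappa ^+ 2)
    else
      pi ^+ k * r ^+ (2 * k) / k.+1%:R
        * ((1 + (kappa ^+ 2 - 1) ^+ k.+1) / kappa ^+ 2))%:E.
Proof.
move=> kappa.
have rn0 : r != 0 by rewrite gt_eqF.
pose f (s : measurableTypeR F) : \bar F := ((pi * `|r ^+ 2 - s|) ^+ k)%:E.
have mf : measurable_fun setT f by exact: measurable_abs_pow.
have f0 s : (0 <= f s)%E by rewrite lee_fin exprn_ge0// mulr_ge0// pi_ge0.
have mX : measurable_fun setT (sqr_norm \o P : T -> measurableTypeR F).
  exact: (measurableT_comp (measurable_sqr_norm F)).
pose X : {RV Pr >-> measurableTypeR F} :=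
  HB.pack (sqr_norm \o P : T -> measurableTypeR F)
    (isMeasurableFun.Build _ _ _ _ _ mX).
have -> : ('E_Pr[fun w => (ellipse_area r (P w) ^+ k)%R]
    = \int[distribution Pr X]_s f s)%E.
  rewrite ge0_integral_distribution// unlock.
  by apply: eq_integral => w _; rewrite /f/= ellipse_areaE.
have law B : measurable B ->
    distribution Pr X B = uniform_disk R (sqr_norm @^-1` B).
  move=> mB; rewrite -hP//.
  by rewrite -[X in measurable X]setTI; exact: measurable_sqr_norm.
have [k0|kn0] := eqVneq kappa 0.
  have R0 : R = 0.
    by move/eqP: k0; rewrite mulf_eq0 invr_eq0 (negbTE rn0) orbF => /eqP.
  rewrite (@eq_measure_integral _ _ _ _ (\d_(0 : measurableTypeR F))).
    rewrite integral_dirac// diracT mul1e /f subr0.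
    by rewrite exprMn ger0_norm ?sqr_ge0// exprM.
  move=> B mB _; apply: (etrans (law B mB)); rewrite /uniform_disk R0 eqxx !diracE.
  congr ((nat_of_bool _)%:R%:E); apply/idP/idP;
    by rewrite !in_setE /= /sqr_norm /= expr0n /= addr0.
have R0 : 0 < R.
  rewrite lt_def hR andbT; apply: contra kn0 => /eqP R0.
  by rewrite /kappa R0 mul0r.
have R20 : 0 < R ^+ 2 by rewrite exprn_gt0.
(* The law of the squared norm, identified by its values on the lower rays. *)
rewrite (@eq_measure_integral _ _ _ _ (uniform_prob R20)); last first.
  move=> B mB _; move: B mB; apply: eq_measure_rays => x.
    by rewrite ltey_eq fin_num_measure.
  apply: (etrans (law _ _)) => //.
  by rewrite uniform_disk_ray// -uniform_prob_ray.
rewrite (integral_uniform _ mf f0) subr0 /f integral_abs_pow ?pi_gt0 ?sqr_ge0//.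
rewrite -EFinM; congr EFin.
have Rn0 : R != 0 by rewrite gt_eqF.
have RE : R = kappa * r by rewrite /kappa divfK.
have kR : (kappa <= 1) = (R ^+ 2 <= r ^+ 2).
  by rewrite ler_sqr ?nnegrE ?(ltW hr)// /kappa ler_pdivrMr// mul1r.
have k1 : k.+1%:R != 0 :> F by rewrite pnatr_eq0.
have rM x : (r ^+ 2 * x) ^+ k.+1 = r ^+ 2 * r ^+ (2 * k) * x ^+ k.+1.
  by rewrite exprMn exprS exprM.
have rE : (r ^+ 2) ^+ k.+1 = r ^+ 2 * r ^+ (2 * k) by rewrite exprS exprM.
rewrite kR; have [Rr|rR] := leP (R ^+ 2) (r ^+ 2).
  rewrite ger0_norm ?subr_ge0// -exprS rE RE.
  rewrite (_ : r ^+ 2 - _ = r ^+ 2 * (1 - kappa ^+ 2)); last by ring.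
  by rewrite rM; field; rewrite nat1r k1 kn0 rn0.
rewrite ltr0_norm ?subr_lt0// -[r ^+ 2 - R ^+ 2]opprB mulNr !opprK -exprS rE RE.
rewrite (_ : _ - r ^+ 2 = r ^+ 2 * (kappa ^+ 2 - 1)); last by ring.
by rewrite rM; field; rewrite nat1r k1 kn0 rn0.
Qed.
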